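(* Let $H$ be a connected hypergraph and let $\bar{H}$ be a $k$-cover of $H$. Then, as multi-sets, the spectrum of $A(\bar{H})$ contains the spectrum of $A(H)$. In particular, if $k=2$, then there is an incidence signing $s$ of $H$ such that, as multi-sets, the spectrum of $A(\bar H)$ is the union of the spectrum of $A(H)$ and the spectrum of $A(H,s)$.
   Context: A hypergraph $H=(V,E)$ consists of a finite vertex set $V$ and a finite family $E$ of subsets of $V$ (edges; repeated edges allowed). For $v\in V$, $E_H(v)$ denotes the set of edges containing $v$. $H$ is connected if any two vertices are joined by a walk $v_0e_1v_1\cdots e_lv_l$ with $v_{i}\neq v_{i+1}$ and $\{v_i,v_{i+1}\}\subseteq e_{i+1}$. The adjacency matrix $A(H)=(a_{uv})$ is indexed by $V$ with $a_{uv}$ equal to the number of edges containing both $u$ and $v$ if $u\neq v$, and $a_{uu}=0$; the spectrum of $H$ means the spectrum of $A(H)$. A homomorphism $\varpi:V(\bar H)\to V(H)$ is a map sending every edge of $\bar H$ onto an edge of $H$; it induces a map $\tilde\varpi$ on edges. It is a covering projection if $\varpi$ is surjective, for every edge $e$ of $\bar H$ the restriction $\varpi|_e:e\to\varpi(e)$ is a bijection, and for every $v\in V(H)$ and every $\bar v\in\varpi^{-1}(v)$ the induced map $\tilde\varpi: E_{\bar H}(\bar v)\to E_H(v)$ is a bijection. If $H$ is connected, every vertex of $H$ has the same number $k$ of preimages (and every edge has $k$ preimage edges); then $\bar H$ is called a $k$-cover of $H$. An incidence signing of $H$ is a map $s$ assigning $s(u,e)\in\{1,-1\}$ to each pair $(u,e)$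 with $e\in E$, $u\in e$. The adjacency matrix of the incidence-signed hypergraph $(H,s)$ is the $V\times V$ matrix with $(u,v)$-entry $\sum_{e\in E:\{u,v\}\subseteq e} s(u,e)s(v,e)$ for $u\neq v$ and $0$ on the diagonal. *)

(* Defs.v *)
From mathcomp Require Import all_boot all_order all_algebra.
From mathcomp Require Import finmap multiset.

Set Implicit Arguments.
Unset Strict Implicit.
Unset Printing Implicit Defensive.

Import GRing.Theory.
Local Open Scope ring_scope.

(* Edges are indexed by a finite type, so that repeated edges are allowed. *)
Record hypergraph := Hypergraph {
  vertex : finType;
  hedge : finType;
  ends : hedge -> {set vertex} }.

Arguments ends {h} e.

Definition star (H : hypergraph) (v : vertex H) : {set hedge H} :=
  [set e | v \in ends e].

Definition walk_step (H : hypergraph) : rel (vertex H) :=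
  [rel u v | (u != v) && [exists e : hedge H, [set u; v] \subset ends e]].

Definition hconnected (H : hypergraph) : Prop :=
  forall u v : vertex H, connect (@walk_step H) u v.

(* Because of repeated edges, the vertex map alone need not determine the
   induced map on edges; a homomorphism therefore carries both maps. *)
Definition is_homomorphism (Hbar H : hypergraph)
    (pv : vertex Hbar -> vertex H) (pe : hedge Hbar -> hedge H) : Prop :=
  forall e : hedge Hbar, pv @: ends e = ends (pe e).

(* The restriction of pv to an edge e is onto ends (pe e) by is_homomorphism,
   so that only its injectivity remains to be required. *)
Definition is_covering (Hbar H : hypergraph)
    (pv : vertex Hbar -> vertex H) (pe : hedge Hbar -> hedge H) : Prop :=
  [/\ is_homomorphism pv pe,
      (forall v : vertex H, exists vbar : vertex Hbar, pv vbar = v),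
      (forall e : hedge Hbar, {in ends e &, injective pv}) &
      (forall vbar : vertex Hbar,
         {in star vbar &, injective pe} /\
         pe @: star vbar = star (pv vbar))].

Definition is_kcover (k : nat) (Hbar H : hypergraph) : Prop :=
  exists (pv : vertex Hbar -> vertex H) (pe : hedge Hbar -> hedge H),
    is_covering pv pe /\
    forall v : vertex H, #|[set vbar | pv vbar == v]| = k.

(* The values of s at non-incident pairs are irrelevant: they never occur in
   signed_adjmx. *)
Definition is_incidence_signing (H : hypergraph)
    (s : vertex H -> hedge H -> int) : Prop :=
  forall (u : vertex H) (e : hedge H),
    u \in ends e -> s u e = 1 \/ s u e = -1.

Definition fin_mx (R : Type) (V : finType) (f : V -> V -> R) : 'M[R]_#|V| :=
  \matrix_(i, j) f (enum_val i) (enum_val j).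

Definition adjmx (R : pzRingType) (H : hypergraph) : 'M[R]_#|vertex H| :=
  fin_mx (fun u v : vertex H =>
    if u == v then 0
    else #|[set e : hedge H | [set u; v] \subset ends e]|%:R).

Definition signed_adjmx (R : pzRingType) (H : hypergraph)
    (s : vertex H -> hedge H -> int) : 'M[R]_#|vertex H| :=
  fin_mx (fun u v : vertex H =>
    if u == v then 0
    else \sum_(e : hedge H | [set u; v] \subset ends e)
           (s u e * s v e)%:~R).

(* Eigenvalues with algebraic multiplicity: closed_field_poly_normal yields a
   sequence r with char_poly A = \prod_(z <- r) ('X - z%:P). *)
Definition spectrum (C : closedFieldType) (n : nat) (A : 'M[C]_n) :
    {mset C}%mset :=
  seq_mset (sval (closed_field_poly_normal (char_poly A))).

(* Main.v *)
Require Import Defs.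
From mathcomp Require Import all_boot all_order all_algebra.
From mathcomp Require Import finmap multiset.

(** Weight the vertices of the cover by signs [eps], and let [L] send a vertex
    of the cover to [eps] times its image. If the product of the weights of two
    vertices on a common edge is the product of the signs of their images, then
    [L] intertwines [A(Hbar)] with the signed adjacency matrix of [H], because
    each edge at a vertex of the cover lies bijectively over an edge at its
    image. For [eps = 1] this embeds the spectrum of [H] in that of [Hbar].
    For a 2-cover, let [eps] be opposite on the two points of each fiber, and
    read the signing off one chosen lift of each edge; any other lift is
    disjoint from it, hence carries the opposite weights. The two maps [L] have
    orthogonal rows, so together they block-diagonalise [A(Hbar)]. *)

Set Implicit Arguments.
Unset Strict Implicit.
Import GRing.Theory Num.Theory.

(** * Characteristic polynomials of intertwined matrices *)

Section CharPoly.
Local Open Scope ring_scope.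

Lemma char_poly_sim (F : fieldType) n (U A B : 'M[F]_n) :
  U \in unitmx -> U *m A = B *m U -> char_poly A = char_poly B.
Proof.
move=> unitU UA.
have nz_detU : \det (map_mx polyC U) != 0.
  by rewrite det_map_mx polyC_eq0 -unitfE -unitmxE.
apply: (mulfI nz_detU); rewrite [RHS]mulrC /char_poly -!det_mulmx.
by rewrite /char_poly_mx mulmxBr mulmxBl -!map_mxM UA scalar_mxC.
Qed.

Lemma char_poly_lblock (R : comNzRingType) m n (A : 'M[R]_m) (C : 'M[R]_(n, m))
    (B : 'M[R]_n) :
  char_poly (block_mx A 0 C B) = char_poly A * char_poly B.
Proof.
rewrite /char_poly /char_poly_mx map_block_mx map_mx0 scalar_mx_block.
by rewrite opp_block_mx add_block_mx subr0 det_lblock.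
Qed.

(** The row space of [L] is stable under [B], which acts on it as [A]. In a basis adapted to [L],
    taken from its Gaussian decomposition, [B] becomes block lower triangular with a conjugate of
    [A] as upper left block. *)
Lemma char_poly_dvd (F : fieldType) m n (L : 'M[F]_(n, m)) (A : 'M_n)
    (B : 'M_m) :
  row_free L -> L *m B = A *m L -> char_poly A %| char_poly B.
Proof.
move=> fL; have le_nm : (n <= m)%N by rewrite -(eqP fL) rank_leq_col.
move: L B fL; rewrite -(subnKC le_nm); move: (m - n)%N => p L B fL LB.
set U := row_ebase L; set E := col_ebase L.
have uU : U \in unitmx by exact: row_ebase_unit.
have uE : E \in unitmx by exact: col_ebase_unit.
have defL : L = E *m row_mx 1%:M 0 *m U.
  by rewrite -pid_mx_row -[LHS]mulmx_ebase (eqP fL).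
set A' := invmx E *m A *m E; set B' := U *m B *m invmx U.
have -> : char_poly A = char_poly A'.
  apply: (@char_poly_sim _ _ (invmx E)); first by rewrite unitmx_inv.
  by rewrite /A' mulmxK.
have -> : char_poly B = char_poly B'.
  by apply: (@char_poly_sim _ _ U); rewrite // /B' mulmxKV.
have : row_mx 1%:M 0 *m B' = A' *m row_mx 1%:M 0.
  apply: (can_inj (mulKmx uE)); apply: (can_inj (mulmxK uU)).
  rewrite /A' /B' !mulmxA mulmxKV // -defL LB mulmxV // mul1mx.
  by rewrite {1}defL !mulmxA.
rewrite -[B']submxK mul_row_block mul_mx_row !mul1mx !mul0mx !addr0 mulmx1.
rewrite mulmx0 => /eq_row_mx[-> ->].
by rewrite char_poly_lblock dvdp_mulr.
Qed.

End CharPoly.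

(** * From divisibility of characteristic polynomials to multisets of eigenvalues *)

Section Spectrum.
Local Open Scope ring_scope.
Variable C : closedFieldType.

Lemma spectrumE n (A : 'M[C]_n) x : spectrum A x = mup x (char_poly A).
Proof.
rewrite /spectrum mset_seqE; case: closed_field_poly_normal => r /= ->.
by rewrite (monicP (char_poly_monic A)) scale1r mu_prod_XsubC.
Qed.

Lemma spectrum_sub m n (A : 'M[C]_m) (B : 'M[C]_n) :
  char_poly A %| char_poly B -> (spectrum A `<=` spectrum B)%mset.
Proof.
move=> dvdAB; apply/msubsetP => x; rewrite !spectrumE.
rewrite mup_geq ?monic_neq0 ?char_poly_monic //.
by apply: dvdp_trans dvdAB; rewrite -mup_geq ?monic_neq0 ?char_poly_monic.
Qed.

Lemma spectrum_mul m n p (A : 'M[C]_m) (B : 'M[C]_n) (D : 'M[C]_p) :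
  char_poly D = char_poly A * char_poly B ->
  spectrum D = (spectrum A `+` spectrum B)%mset.
Proof.
move=> eqD; apply/msetP => x.
by rewrite msetE2 !spectrumE eqD mupM ?monic_neq0 ?char_poly_monic.
Qed.

End Spectrum.

(** * Coverings, intertwining matrices and the signing *)

Section Covering.
Local Open Scope ring_scope.

(** This lets a single intertwining lemma serve both the plain and the signed matrix of [H]. *)
Lemma adjmx_signed (R : pzRingType) (H : hypergraph) :
  adjmx R H = signed_adjmx R (fun (_ : vertex H) (_ : hedge H) => 1).
Proof.
apply/matrixP => i j; rewrite !mxE; case: eqP => // _.
rewrite -sum1_card natr_sum; apply: eq_big => [e|e _]; first by rewrite inE.
by rewrite mulr1.
Qed.

Variables (H Hbar : hypergraph).
Variables (pv : vertex Hbar -> vertex H) (pe : hedge Hbar -> hedge H).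
Hypothesis cov : is_covering pv pe.

Lemma covering_lift f v : v \in ends (pe f) ->
  exists2 x, x \in ends f & pv x = v.
Proof.
by case: cov => hom _ _ _; rewrite -hom => /imsetP[x xf ->]; exists x.
Qed.

Lemma covering_mem f x : x \in ends f -> pv x \in ends (pe f).
Proof. by case: cov => hom _ _ _ xf; rewrite -hom imset_f. Qed.

Lemma covering_edge_inj f : {in ends f &, injective pv}.
Proof. by case: cov. Qed.

Lemma covering_star_inj f g x :
  x \in ends f -> x \in ends g -> pe f = pe g -> f = g.
Proof.
by case: cov => _ _ _ /(_ x)[inj _] xf xg; apply: inj; rewrite inE.
Qed.

Section Intertwining.
Variable R : comPzRingType.

(** Multiplying a row vector on [H] by this matrix lifts it along [pv], with weights [eps]. *)
Definition fiber_mx (eps : vertex Hbar -> int) :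
    'M[R]_(#|vertex H|, #|vertex Hbar|) :=
  \matrix_(i, j)
    if pv (enum_val j) == enum_val i then (eps (enum_val j))%:~R else 0.

Lemma fiber_mx_intertwine (eps : vertex Hbar -> int)
    (s : vertex H -> hedge H -> int) :
    (forall x, eps x * eps x = 1) ->
    (forall f x y, x \in ends f -> y \in ends f ->
       s (pv x) (pe f) * s (pv y) (pe f) = eps x * eps y) ->
  fiber_mx eps *m adjmx R Hbar = signed_adjmx R s *m fiber_mx eps.
Proof.
move=> eps2 eps_s; rewrite adjmx_signed.
apply/matrixP => i j; rewrite !mxE.
set v := enum_val i; set w := enum_val j.
transitivity (\sum_(x | pv x == v)
    if x == w then 0
    else \sum_(f | [set x; w] \subset ends f) (eps x)%:~R : R).
  rewrite [RHS]big_mkcond /= [RHS]big_enum_val; apply: eq_bigr => l _.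
  rewrite !mxE -/w; case: (pv _ == v); last by rewrite mul0r.
  case: eqP => _; first by rewrite mulr0.
  by rewrite big_distrr /=; apply: eq_bigr => f _; rewrite -[RHS]mulr1.
(* On the right, column [w] of [fiber_mx eps] is supported on the row of [pv w], so one term
   survives. *)
transitivity ((if v == pv w then 0
    else \sum_(e | [set v; pv w] \subset ends e) (s v e * s (pv w) e)%:~R) *
    (eps w)%:~R : R); last first.
  rewrite [RHS](bigD1 (enum_rank (pv w))) //= [X in _ + X]big1 ?addr0 => [|l].
    by rewrite !mxE -/w -/v enum_rankK eqxx.
  rewrite [X in _ * X]mxE -/w => ne_l.
  case: eqP => [eq_l|]; last by rewrite mulr0.
  by rewrite eq_l enum_valK eqxx in ne_l.
(* If [w] lies over [v], the left side vanishes too: [pv] is injective on edges, so no edge contains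
   two points of a fiber. *)
case: eqP => [->|/eqP ne_vw].
  rewrite mul0r big1 // => x /eqP eq_xw; case: eqP => // ne_xw.
  rewrite big1 // => f; rewrite subUset !sub1set => /andP[xf wf].
  by case: ne_xw; apply: (covering_edge_inj xf wf).
transitivity (\sum_(f | w \in ends f)
    \sum_(x | (pv x == v) && (x \in ends f)) (eps x)%:~R : R).
  rewrite [RHS](exchange_big_dep (fun x => pv x == v)) /=; last first.
    by move=> f x _ /andP[].
  apply: eq_bigr => x /eqP xv.
  have /negPf-> : x != w by apply: contraNneq ne_vw => <-; rewrite xv.
  by apply: eq_bigl => f; rewrite subUset !sub1set andbC xv eqxx.
(* An edge [f] at [w] has exactly one point [x] over [v] if [v] is in [ends (pe f)], and none
   otherwise; [eps x] is rewritten as [(eps x * eps w) * eps w]. *)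
transitivity (\sum_(f in star w | v \in ends (pe f))
    (s v (pe f) * s (pv w) (pe f) * eps w)%:~R : R).
  rewrite big_mkcondr /=; apply: eq_big => [f|f wf]; first by rewrite inE.
  case: ifP => [vf|vNf].
    have [x xf xv] := covering_lift vf.
    rewrite (big_pred1 x) => [|y].
      by rewrite -xv eps_s // -mulrA eps2 mulr1.
    apply/andP/eqP => [[/eqP yv yf]|-> //]; last by rewrite xv.
    by apply: (covering_edge_inj yf xf); rewrite yv.
  rewrite big1 // => x /andP[/eqP xv xf].
  by rewrite -xv covering_mem in vNf.
(* Reindex along the bijection [pe] from the star of [w] to the star of [pv w]. *)
have [_ _ _ /(_ w)[inj_star im_star]] := cov.
rewrite mulr_suml.
transitivity (\sum_(e in pe @: star w | v \in ends e)
    (s v e * s (pv w) e * eps w)%:~R : R).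
  by rewrite big_mkcondr [RHS]big_mkcondr /= big_imset.
rewrite im_star; apply: eq_big => [e|e _]; last by rewrite -intrM.
by rewrite subUset !sub1set inE andbC.
Qed.

(** Rows of distinct vertices are supported on disjoint fibers. *)
Lemma fiber_mx_dot (eps1 eps2 : vertex Hbar -> int) (c : int) :
    (forall v, \sum_(x | pv x == v) eps1 x * eps2 x = c) ->
  fiber_mx eps1 *m (fiber_mx eps2)^T = (c%:~R)%:M.
Proof.
move=> sumc; apply/matrixP => i j; rewrite !mxE.
under eq_bigr do rewrite !mxE.
have [<-|ne_ij] := eqVneq i j.
  rewrite mulr1n -(sumc (enum_val i)) rmorph_sum /= [RHS]big_mkcond.
  rewrite [RHS]big_enum_val.
  by apply: eq_bigr => l _; case: eqP => _; rewrite ?mul0r // intrM.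
rewrite mulr0n big1 // => l _.
case: eqP => [->|_]; last by rewrite mul0r.
by rewrite (inj_eq enum_val_inj) (negPf ne_ij) mulr0.
Qed.

End Intertwining.

Section DoubleCover.
Hypothesis card_fiber2 : forall v, #|[set x | pv x == v]| = 2.

(** The [pick] depends on [x] only through [pv x], so it marks one point in each fiber. *)
Definition sheet_sign (x : vertex Hbar) : int :=
  if [pick y | pv y == pv x] == Some x then 1 else -1.

(* Both [pick]s succeed when [u \in ends e]; the default value 1 is only
   reached at non-incident pairs. *)
Definition cover_sign (u : vertex H) (e : hedge H) : int :=
  if [pick f | pe f == e] is Some f then
    if [pick x in ends f | pv x == u] is Some x then sheet_sign x else 1
  else 1.

Lemma sheet_signP x : sheet_sign x = 1 \/ sheet_sign x = -1.
Proof. by rewrite /sheet_sign; case: ifP; [left | right]. Qed.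

Lemma sheet_sign_sqr x : sheet_sign x * sheet_sign x = 1.
Proof. by case: (sheet_signP x) => ->. Qed.

Lemma cover_sign_signing : is_incidence_signing cover_sign.
Proof.
move=> u e _; rewrite /cover_sign.
case: pickP => [f _|_]; last by left.
by case: pickP => [x _|_]; [exact: sheet_signP | left].
Qed.

Lemma fiber_pair x y z :
  pv x = pv y -> x != y -> (pv z == pv x) = (z == x) || (z == y).
Proof.
move=> pxy nxy.
have sub : [set x; y] \subset [set z | pv z == pv x].
  by rewrite subUset !sub1set !inE pxy !eqxx.
have /eqP/setP/(_ z) : [set x; y] == [set z | pv z == pv x].
  by rewrite eqEcard sub card_fiber2 cards2 nxy.
by rewrite !inE => ->.
Qed.

Lemma sheet_sign_opp x y :
  pv x = pv y -> x != y -> sheet_sign y = - sheet_sign x.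
Proof.
move=> pxy nxy; rewrite /sheet_sign -pxy.
case: pickP => [z|/(_ x)]; last by rewrite eqxx.
rewrite (fiber_pair _ pxy nxy) => /orP[]/eqP->.
  by rewrite eqxx (inj_eq Some_inj) (negPf nxy).
by rewrite eqxx (inj_eq Some_inj) eq_sym (negPf nxy) opprK.
Qed.

Lemma sum_sheet_sign v : \sum_(x | pv x == v) sheet_sign x = 0.
Proof.
have /cards2P[x [y [nxy defF]]] : #|[set x | pv x == v]| == 2%N.
  by rewrite card_fiber2.
have inF z : (pv z == v) = (z \in [set x; y]) by rewrite -defF inE.
have xv : pv x = v by apply/eqP; rewrite inF !inE eqxx.
have yv : pv y = v by apply/eqP; rewrite inF !inE eqxx orbT.
rewrite (eq_bigl _ _ inF) big_setU1 ?inE //= big_set1.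
by rewrite (sheet_sign_opp _ nxy) ?subrr // xv.
Qed.

(** The signs are read off a chosen lift [g] of [pe f]. If [g] differs from [f], the two share no
    vertex, so [g] passes through the other point of each fiber that [f] meets; all signs flip
    together. *)
Lemma cover_sign_lift f : exists2 c : int, c * c = 1 &
  forall x, x \in ends f -> cover_sign (pv x) (pe f) = c * sheet_sign x.
Proof.
rewrite /cover_sign.
case: pickP => [g /eqP gf|/(_ f)]; last by rewrite eqxx.
exists (if g == f then 1 else -1) => [|x xf]; first by case: ifP.
case: pickP => [y /andP[yg /eqP yx]|noy].
  case: eqP => [eq_gf|ne_gf].
    rewrite mul1r; congr sheet_sign; rewrite eq_gf in yg.
    exact: (covering_edge_inj yg xf).
  rewrite mulN1r; apply: sheet_sign_opp => //; apply/eqP => eq_xy.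
  by apply: ne_gf; apply: (covering_star_inj yg _ gf); rewrite -eq_xy.
have /covering_lift[y yg yx] : pv x \in ends (pe g) by rewrite gf covering_mem.
by have := noy y; rewrite /= yg yx eqxx.
Qed.

Lemma cover_sign_mul f x y : x \in ends f -> y \in ends f ->
  cover_sign (pv x) (pe f) * cover_sign (pv y) (pe f)
    = sheet_sign x * sheet_sign y.
Proof.
by case: (cover_sign_lift f) => c c2 sE xf yf; rewrite !sE // mulrACA c2 mul1r.
Qed.

End DoubleCover.

Lemma card_cover k : (forall v, #|[set x | pv x == v]| = k) ->
  #|vertex Hbar| = (#|vertex H| * k)%N.
Proof.
move=> cardk; rewrite -sum1_card (partition_big pv predT) //=.
rewrite -sum_nat_const; apply: eq_bigr => v _; rewrite -(cardk v) -sum1_card.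
by apply: eq_bigl => x; rewrite inE.
Qed.

End Covering.

(** * Spectra of covers *)

Section KCover.
Local Open Scope ring_scope.
Variables (H Hbar : hypergraph).
Variables (pv : vertex Hbar -> vertex H) (pe : hedge Hbar -> hedge H).
Hypothesis cov : is_covering pv pe.

Lemma cover_sum1 k v : #|[set x | pv x == v]| = k ->
  \sum_(x | pv x == v) (1 * 1 : int) = k%:Z.
Proof.
move=> <-; rewrite -sum1_card -[RHS]natz natr_sum.
by apply: eq_bigl => x; rewrite inE.
Qed.

Lemma spectrum_cover_sub (C : numClosedFieldType) k :
    (forall v, #|[set x | pv x == v]| = k) ->
  (spectrum (adjmx C H) `<=` spectrum (adjmx C Hbar))%mset.
Proof.
move=> cardk; apply: spectrum_sub.
apply: (@char_poly_dvd _ _ _ (fiber_mx pv C (fun=> 1))).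
  have := fiber_mx_dot C (fun v => cover_sum1 (cardk v)).
  (* For [k > 0], the transpose divided by [k] is a right inverse. For [k = 0], surjectivity of [pv]
     leaves [H] without vertices, so the matrix has no rows. *)
  have [k0 _|k_gt0 LL] := posnP k.
    rewrite -row_leq_rank leqNgt; apply/negP => /(leq_ltn_trans (leq0n _)).
    case/card_gt0P => v _; have [_ /(_ v)[x xv] _ _] := cov.
    have /card0_eq/(_ x) : #|[set x | pv x == v]| = 0%N by rewrite cardk.
    by rewrite !inE xv eqxx.
  apply/row_freeP; exists (k%:R^-1 *: (fiber_mx pv C (fun=> 1))^T).
  rewrite -scalemxAr LL scale_scalar_mx pmulrn mulVf // -pmulrn pnatr_eq0.
  by rewrite -lt0n.
by rewrite [adjmx C H]adjmx_signed; apply: (fiber_mx_intertwine cov C).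
Qed.

Lemma spectrum_double_cover (C : numClosedFieldType) :
    (forall v, #|[set x | pv x == v]| = 2) ->
  spectrum (adjmx C Hbar) =
    (spectrum (adjmx C H) `+` spectrum (signed_adjmx C (cover_sign pv pe)))%mset.
Proof.
move=> card2; apply: spectrum_mul.
set A := adjmx C H; set S := signed_adjmx C _.
pose L1 := fiber_mx pv C (fun=> 1); pose L2 := fiber_mx pv C (sheet_sign pv).
have eqA : L1 *m adjmx C Hbar = A *m L1.
  by rewrite /A [adjmx C H]adjmx_signed; apply: (fiber_mx_intertwine cov C).
have eqS : L2 *m adjmx C Hbar = S *m L2.
  apply: (fiber_mx_intertwine cov C); first exact: sheet_sign_sqr.
  exact: cover_sign_mul.
have L11 : L1 *m L1^T = 2%:M.
  by rewrite (fiber_mx_dot C (fun v => cover_sum1 (card2 v))) -pmulrn.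
have L22 : L2 *m L2^T = 2%:M.
  rewrite (fiber_mx_dot C (c := 2)) // => v.
  by under eq_bigr do rewrite sheet_sign_sqr -[1]mulr1; exact: cover_sum1.
have L12 : L1 *m L2^T = 0.
  rewrite (fiber_mx_dot C (c := 0)) ?mulr0z ?raddf0 // => v.
  by under eq_bigr do rewrite mul1r; exact: sum_sheet_sign.
have L21 : L2 *m L1^T = 0 by rewrite -[LHS]trmxK trmx_mul trmxK L12 trmx0.
(* The stacked matrix is square only up to the equation between the vertex counts. Divisibility
   avoids a cast: both polynomials are monic, and equal degrees then give equality. *)
have dvdB : char_poly (block_mx A 0 0 S) %| char_poly (adjmx C Hbar).
  apply: (@char_poly_dvd _ _ _ (col_mx L1 L2)).
    apply/row_freeP; exists (2^-1 *: (col_mx L1 L2)^T).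
    rewrite -scalemxAr tr_col_mx mul_col_row L11 L12 L21 L22.
    by rewrite -scalar_mx_block scale_scalar_mx mulVf // pnatr_eq0.
  by rewrite mul_col_mx mul_block_col !mul0mx addr0 add0r eqA eqS.
rewrite -(char_poly_lblock A 0 S); apply/esym/eqP.
rewrite -eqp_monic ?char_poly_monic // -dvdp_size_eqp //.
by rewrite !size_char_poly (card_cover card2) muln2 addnn.
Qed.

End KCover.

Theorem theorem1p3 (C : numClosedFieldType) (H Hbar : hypergraph) (k : nat)
    (connH : hconnected H) (coverH : is_kcover k Hbar H) :
  (spectrum (adjmx C H) `<=` spectrum (adjmx C Hbar))%mset /\
  (k = 2 ->
   exists s : vertex H -> hedge H -> int,
     is_incidence_signing s /\
     spectrum (adjmx C Hbar) =
       (spectrum (adjmx C H) `+` spectrum (signed_adjmx C s))%mset).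
Proof.
case: coverH => pv [pe [cov cardk]]; split.
  exact: (spectrum_cover_sub cov C cardk).
move=> k2; exists (cover_sign pv pe); split; first exact: cover_sign_signing.
by apply: (spectrum_double_cover cov) => v; rewrite cardk.
Qed.
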